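(* Assume $\Diamond$. Then there exists a rigid infinite Fedorchuk space; that is, there is an infinite compact Hausdorff, hereditarily separable space $X$ with no non-trivial convergent sequences such that the only homeomorphism of $X$ onto $X$ is the identity map.
   Context: $\Diamond$ is Jensen's diamond principle: there is a sequence $\langle A_\alpha:\alpha<\omega_1\rangle$ with $A_\alpha\subseteq\alpha$ such that for every $A\subseteq\omega_1$ the set $\{\alpha<\omega_1:A\cap\alpha=A_\alpha\}$ is stationary in $\omega_1$. A space is hereditarily separable if every subspace is separable. A convergent sequence is non-trivial if it is not eventually constant. A Fedorchuk space is a compact (Hausdorff), hereditarily separable space with no non-trivial convergent sequences. A space is rigid if its only autohomeomorphism is the identity. *)

(* Defs.v *)
From HB Require Import structures.
From mathcomp Require Import all_boot all_order.
From mathcomp Require Import all_classical.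
From mathcomp Require Import topology.

Set Implicit Arguments.
Unset Strict Implicit.
Unset Printing Implicit Defensive.

Local Open Scope order_scope.
Local Open Scope classical_set_scope.

(* The linear order W is isomorphic to the ordinal omega_1: a well-order that
   is uncountable and all of whose proper initial segments are countable. *)
Definition is_omega1 (d : Order.disp_t) (W : orderType d) : Prop :=
  [/\ wochoice.well_order (<=%O : rel W),
      ~ countable [set: W] &
      forall a : W, countable [set x : W | x < a]].

(* The first clause of `is_limit` excludes the least element: zero is not a
   limit ordinal. *)
Definition is_limit (d : Order.disp_t) (W : orderType d) (a : W) : Prop :=
  (exists b : W, b < a) /\ (forall b : W, b < a -> exists2 c : W, b < c & c < a).

Definition is_club (d : Order.disp_t) (W : orderType d) (C : set W) : Prop :=
  (forall a : W, exists2 c : W, C c & a < c) /\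
  (forall a : W, is_limit a ->
     (forall b : W, b < a -> exists2 c : W, C c & b < c < a) -> C a).

Definition stationary (d : Order.disp_t) (W : orderType d) (S : set W) : Prop :=
  forall C : set W, is_club C -> S `&` C !=set0.

Definition diamond_sequence (d : Order.disp_t) (W : orderType d)
    (A : W -> set W) : Prop :=
  (forall a : W, A a `<=` [set x : W | x < a]) /\
  (forall S : set W, stationary [set a : W | S `&` [set x : W | x < a] = A a]).

(* The order type omega_1 is unique up to isomorphism, so it does not matter
   which realization of it is used. *)
Definition diamond : Prop :=
  exists (d : Order.disp_t) (W : orderType d),
    is_omega1 W /\ exists A : W -> set W, diamond_sequence A.

Definition separable (X : topologicalType) : Prop :=
  exists2 D : set X, countable D & dense D.

(* `set_type A` carries the subspace topology; the type `subspace A` would not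
   do, since there the points outside A are isolated rather than removed. *)
Definition hereditarily_separable (X : topologicalType) : Prop :=
  forall A : set X, separable (set_type A).

Definition eventually_constant (X : Type) (u : nat -> X) : Prop :=
  exists c : X, \forall n \near \oo, u n = c.

Definition no_nontrivial_convergent_sequence (X : topologicalType) : Prop :=
  forall (u : nat -> X) (x : X), u @ \oo --> x -> eventually_constant u.

Definition fedorchuk_space (X : topologicalType) : Prop :=
  [/\ compact [set: X], hausdorff_space X, hereditarily_separable X &
      no_nontrivial_convergent_sequence X].

Definition homeomorphism (X Y : topologicalType) (f : X -> Y) : Prop :=
  continuous f /\
  exists g : Y -> X, [/\ continuous g, cancel f g & cancel g f].

Definition rigid (X : topologicalType) : Prop :=
  forall f : X -> X, homeomorphism f -> f =1 id.

(* Main.v *)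
Require Import Defs.
From mathcomp Require Import all_boot all_order.
From mathcomp Require Import all_classical.
From mathcomp Require Import topology.

Set Implicit Arguments.
Unset Strict Implicit.
Unset Printing Implicit Defensive.

Import Order.TTheory.
Local Open Scope order_scope.
Local Open Scope classical_set_scope.

(* The space is a closed subset X of the cube 2^(nat + omega_1). Membership in X
   is decided coordinate by coordinate: at stage g a point x_g guessed by diamond
   is split in two, and for a point y off the fibre of x_g the coordinate y(g) is
   a function L_g of the first place k, in an enumeration of the earlier
   coordinates, where y differs from x_g. As in Fedorchuk's construction, L_g is
   chosen so that, for countably many promised sets D of points of earlier
   stages, if the fibres over the points of D accumulate at x_g, then they
   accumulate at both halves of x_g.
   At stage g diamond also guesses two families u and v of points; u is
   promised, and so are, from stage g + 1 on, the two parts of v lying over the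
   two halves of u.
   - A left-separated omega_1-sequence, guessed as u at a large stage g, has its
     g-th term in the closure of the earlier ones; so X is hereditarily separable.
   - A sequence guessed as u together with its limit x is not convergent after
     the splitting of x.
   - If h is a homeomorphism with h x <> x, guess x, a sequence u_n accumulating
     at x, and v_n = h(u_n). For both values b, h x is in the closure of the v_n
     with u_n(g) = b, hence x is in the closure of the u_n with u_n(g) = b: this
     fails for b <> x(g). *)

(** * Countable sets and finite sequences *)

Lemma countable_image (T U : Type) (f : T -> U) (A : set T) :
  countable A -> countable (f @` A).
Proof. exact/sub_countable/card_image_le. Qed.

Lemma countable_range (T : Type) (A : set T) : countable A -> A !=set0 ->
  exists u : nat -> T, range u = A.
Proof.
move=> /countable_injP[f fI] [a0 Aa0].
have /choice[u uP] n : exists a, A a /\ forall b, A b -> f b = n -> a = b.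
  have [[a [Aa fa]]|na] := pselect (exists a, A a /\ f a = n).
    by exists a; split=> // b Ab fb; apply: fI; rewrite ?inE// fa.
  by exists a0; split=> // b Ab fb; exfalso; apply: na; exists b.
exists u; apply/seteqP; split=> [_ [n _ <-]|b Ab]; first by have [] := uP n.
by exists (f b) => //; apply: (uP (f b)).2.
Qed.

Lemma countableU (T : Type) (A B : set T) :
  countable A -> countable B -> countable (A `|` B).
Proof.
move=> cA cB; rewrite (_ : A `|` B = \bigcup_b (if b then A else B)).
  by apply: bigcup_countable => [|[] _] //; apply: countableP.
apply/seteqP; split=> [x [Ax|Bx]|x [[] _ ?]];
  by [exists true|exists false|left|right].
Qed.

Lemma countable_seq (T : eqType) (A : set T) : countable A ->
  countable [set s : seq T | forall x, x \in s -> A x].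
Proof.
move=> /countable_injP[f fI].
apply/countable_injP; exists (fun s => pickle (map f s)).
move=> s t /set_mem As /set_mem At /(pcan_inj pickleK).
elim: s t As At => [|x s IH] [|y t] //= As At [exy est].
have exy' : x = y.
  by apply: fI exy; apply: mem_set; [apply: As|apply: At]; rewrite mem_head.
rewrite exy' (IH t) // => z zs; [apply: As|apply: At]; exact: mem_behead.
Qed.

(** * Recursion, bounds and clubs on omega_1 *)

Section Omega1.
Context (d : Order.disp_t) (W : orderType d) (W1 : is_omega1 W).

Lemma omega1_min (A : set W) : A !=set0 ->
  exists2 a : W, A a & forall b, A b -> a <= b.
Proof.
case: W1 => wo _ _ [a Aa].
have [|z [[zA zmin] _]] := wo [pred x | `[< A x >]].
  by exists a; apply/asboolP.
exists z; first exact/asboolP.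
by move=> b Ab; apply: zmin; apply/asboolP.
Qed.

Lemma omega1_wf : well_founded (fun a b : W => a < b).
Proof.
move=> a; apply: contrapT => nacc.
have [b nb bmin] := @omega1_min [set x | ~ Acc (fun a b : W => a < b) x]
  (ex_intro _ a nacc).
apply: nb; constructor => c cb; apply: contrapT => nc.
by have := bmin _ nc; rewrite leNgt cb.
Qed.

Lemma omega1_ind (P : W -> Prop) :
  (forall a, (forall b, b < a -> P b) -> P a) -> forall a, P a.
Proof. by move=> IH a; elim: (omega1_wf a) => {}a _; apply: IH. Qed.

(** Since [R a f] depends only on [f] below [a], the choice at [a] can be made for [f] cut off there
    by the default [t0], which is what well-founded recursion provides. *)
Lemma omega1_rec_choice (T : Type) (t0 : T) (R : W -> (W -> T) -> T -> Prop) :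
  (forall a f g t, (forall b, b < a -> f b = g b) -> R a f t -> R a g t) ->
  (forall a f, (forall b, b < a -> R b f (f b)) -> exists t, R a f t) ->
  exists f, forall a, R a f (f a).
Proof.
move=> Rloc Rex.
pose ext a (rec : forall b, b < a -> T) (b : W) : T :=
  if pselect (b < a) is left h then rec b h else t0.
pose pick a g := if pselect (exists t, R a g t) is left h then projT1 (cid h) else t0.
have pickP a g : (exists t, R a g t) -> R a g (pick a g).
  by move=> h; rewrite /pick; case: pselect => // h'; apply: projT2.
pose F a (rec : forall b, b < a -> T) : T := pick a (ext a rec).
pose f := Fix omega1_wf (fun=> T) F.
have fE a : f a = pick a (fun b => if pselect (b < a) then f b else t0).
  rewrite {1}/f Fix_eq; last first.
    move=> x g1 g2 g12; congr F.
    by apply: functional_extensionality_dep => y;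
       apply: functional_extensionality_dep.
  by congr pick; apply/funext => b; rewrite /ext; case: pselect.
exists f; elim/omega1_ind => a IH.
have [t Rt] := Rex a f IH.
pose g b := if pselect (b < a) then f b else t0.
have fg b : b < a -> f b = g b by rewrite /g; case: pselect.
apply: (Rloc a g); first by move=> b /fg.
rewrite fE; apply: pickP; exists t; exact: Rloc Rt.
Qed.

Lemma countable_lt (a : W) : countable [set x | x < a].
Proof. by case: W1. Qed.

Lemma countable_le (a : W) : countable [set x | x <= a].
Proof.
apply: sub_countable (countableU (countable_lt a) (countable1 a)).
by apply: subset_card_le => x /=; rewrite le_eqVlt => /orP[/eqP->|]; [right|left].
Qed.

Lemma countable_bounded (B : set W) : countable B ->
  exists c, forall b, B b -> b < c.
Proof.
move=> cB; apply: contrapT => unb; case: W1 => _ + _; apply.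
apply: sub_countable (bigcup_countable cB (fun b _ => countable_le b)).
apply: subset_card_le => c _ /=; apply: contrapT => nc; apply: unb.
exists c => b Bb; rewrite ltNge; apply/negP => cb; apply: nc; by exists b.
Qed.

Lemma omega1_inhabited : exists a : W, forall b, a <= b.
Proof.
have [c _] := countable_bounded (@countable0 W).
have [a _ amin] := @omega1_min setT (ex_intro _ c I).
by exists a => b; apply: amin.
Qed.

Lemma omega1_gt (a : W) : exists c, a < c.
Proof. by have [c h] := countable_bounded (countable1 a); exists c; apply: h. Qed.

Lemma sup_sequence (u : nat -> W) : (forall n, u n < u n.+1) ->
  exists c, (forall n, u n < c) /\ forall b, b < c -> exists n, b < u n.
Proof.
move=> uS.
have [|c cu cmin] := @omega1_min [set c | forall n, u n < c].
  have [c h] := countable_bounded (countable_image u (countableP setT)).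
  by exists c => n; apply: h; exists n.
exists c; split=> // b bc; apply: contrapT => nb.
suff: c <= b by rewrite leNgt bc.
apply: cmin => n /=; apply: lt_le_trans (uS n) _.
by rewrite leNgt; apply/negP => h; apply: nb; exists n.+1.
Qed.

(** For unboundedness, [s b] bounds [b] and the values of [K] at all arguments up to [b], so the
    supremum of the iterates of [s] is closed under [K]. *)
Lemma club_closure (bot : W) (K : W -> set W) : (forall b, bot <= b) ->
  (forall b, countable (K b)) ->
  is_club [set a : W | bot < a /\ forall b c, b < a -> K b c -> c < a].
Proof.
move=> botP cK; split.
- move=> a.
  have step (b : W) : exists c, b < c /\ forall b' c', b' <= b -> K b' c' -> c' < c.
    have [c h] := countable_bounded
      (countableU (countable1 b) (bigcup_countable (countable_le b) (fun b' _ => cK b'))).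
    by exists c; split=> [|b' c' b'b Kc]; apply: h; [left|right; exists b'].
  have [s sP] := choice step.
  pose u n := iter n s a.
  have [c [uc cu]] := @sup_sequence u (fun n => (sP (u n)).1).
  exists c; last exact: (uc 0).
  split; first exact: le_lt_trans (botP _) (uc 0).
  move=> b b' /cu[n bn] Kb; apply: lt_trans (uc n.+1).
  by apply: (sP (u n)).2 Kb; apply: ltW.
- move=> a [[b0 b0a] _] acl; split; first exact: le_lt_trans (botP _) b0a.
  move=> b b' ba Kb; have [c [_ cK'] /andP[bc ca]] := acl b ba.
  exact: lt_trans (cK' _ _ bc Kb) ca.
Qed.

(** Only countably many values are taken before stage [a], so their complement is infinite and has
    room for a fresh sequence. *)
Lemma omega1_nat_injection : exists f : W -> nat -> W,
  forall a b n m, f a n = f b m -> a = b /\ n = m.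
Proof.
have [bot _] := omega1_inhabited.
have := @omega1_rec_choice (nat -> W) (fun=> bot) (fun a f t =>
  injective t /\ forall b n m, b < a -> t n <> f b m).
case=> [a f g t fg [ti th]|a f _|f fP].
- by split=> // b n m ba; rewrite -fg//; apply: th.
- pose B := \bigcup_(b in [set x : W | x < a]) range (f b).
  have cB : countable B.
    apply: bigcup_countable (countable_lt a) _ => b _.
    exact: countable_image (countableP _).
  have /infiniteP/card_leP[h] : infinite_set (~` B).
    move=> /finite_set_countable cB'; case: W1 => _ + _; apply.
    by rewrite -(setUv B); apply: countableU.
  pose i n : set_type [set: nat] := SigSub (mem_set I : n \in [set: nat]).
  exists (fun n => val (h (i n))); split=> [n m /val_inj e|b n m ba e].
    by have /(congr1 val) := 'inj_h (mem_set I) (mem_set I) e.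
  by apply: (set_mem (valP (h (i n)))); exists b => //; exists m.
- exists f => a b n m e; have [fi fd] := fP a; have [_ gd] := fP b.
  case: (ltgtP a b) => [ab|ba|ab].
  + by case: (gd a m n ab).
  + by case: (fd b n m ba).
  + by subst b; split=> //; apply: fi.
Qed.

End Omega1.

(** * Guessing by diamond *)

Section Guess.
Context (d : Order.disp_t) (W : orderType d) (W1 : is_omega1 W).

Definition coord : Type := (nat + W)%type.

(** The coordinates [inl n] are present at every stage; [below a] selects the coordinates of stage
    [a], and [upto a] those of its successor. *)
Definition below (a : W) (i : coord) : bool := if i is inr b then b < a else true.
Definition upto (a : W) (i : coord) : bool := if i is inr b then b <= a else true.

Lemma below_lt a b i : a <= b -> below a i -> below b i.
Proof. by case: i => //= c ab ca; apply: lt_le_trans ab. Qed.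

Lemma upto_trans a b i : a <= b -> upto a i -> upto b i.
Proof. by case: i => //= c ab ca; apply: le_trans ab. Qed.

(** With this, inductions over stages treat successors and limits alike: finitely many coordinates
    of stage [a] are already present at the successor of some [b < a]. *)
Lemma below_exists (bot a : W) (s : seq coord) : bot < a ->
  (forall i, i \in s -> below a i) ->
  exists b, [/\ bot <= b, b < a & forall i, i \in s -> upto b i].
Proof.
move=> ba; elim: s => [|i s IH] sa; first by exists bot.
have [j js|b [botb bltb bs]] := IH; first by apply: sa; rewrite inE js orbT.
have : below a i by apply: sa; rewrite mem_head.
case: i {sa} => [n _|c /= ca].
  by exists b; split=> // j; rewrite inE => /orP[/eqP->//|/bs].
exists (Order.max b c); split; rewrite ?le_max ?botb// ?gt_max ?bltb//.
move=> j; rewrite inE => /orP[/eqP->/=|/bs]; first by rewrite le_max lexx orbT.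
by apply: upto_trans; rewrite le_max lexx.
Qed.

Lemma countable_upto a : countable [set i | upto a i].
Proof.
rewrite (_ : [set i | upto a i] = (inl @` setT) `|` (inr @` [set b | b <= a])).
  apply: countableU; apply: countable_image => //.
  exact: countable_le.
apply/seteqP; split=> [[n|b] /= ?|i [[n _ <-]|[b ? <-]]] //.
  by left; exists n.
by right; exists b.
Qed.

Lemma countable_below a : countable [set i | below a i].
Proof.
apply: sub_countable (countable_upto a); apply: subset_card_le => i.
by case: i => //= b /ltW.
Qed.

(* A function on [T * W * coord] is coded as a subset of [W] by an injection into
   [W]; club many stages are closed under this injection and under [psi]. *)
Lemma diamond_guess (T : countType) (bot : W) (A : W -> set W) :
  (forall b, bot <= b) -> diamond_sequence A ->
  exists G : W -> T -> W -> coord -> bool,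
  forall (F : T -> W -> coord -> bool) (psi : seq (coord * bool) -> W),
  exists a, [/\ bot < a,
    forall p, (forall i, i \in p -> below a i.1) -> psi p < a &
    forall t b i, b < a -> below a i -> G a t b i = F t b i].
Proof.
move=> botP [_ diaA].
have [f fI] := omega1_nat_injection W1.
have /choice[g gI] : forall a : W, exists g : W -> nat,
    {in [set b | b <= a] &, injective g}.
  by move=> a; apply/countable_injP/countable_le.
(* Both [b] and the ordinal in [i] are at most [top b i], so [g (top b i)] turns them into natural
   numbers; [f] then codes [top b i] together with a natural number. *)
pose top b (i : coord) := if i is inr c then Order.max b c else b.
pose code m (i : coord) : nat + nat := match i with inl n => inl n | inr c => inr (g m c) end.
pose e (t : T) b i : W := f (top b i) (pickle (t, g (top b i) b, code (top b i) i)).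
have eI t t' b b' i i' : e t b i = e t' b' i' -> [/\ t = t', b = b' & i = i'].
  move=> /fI[te /(pcan_inj pickleK)[-> ge ie]].
  have bt b1 i1 : b1 <= top b1 i1 by case: i1 => //= c; rewrite le_max lexx.
  split=> //.
    by move: ge; rewrite te; apply: gI; apply: mem_set => //=; rewrite -te.
  case: i i' te ie {ge} => [n|c] [n'|c'] //= te [].
    by move=> ->.
  rewrite te => h; congr inr; apply: gI h; apply: mem_set => /=; last first.
    by rewrite le_max lexx orbT.
  by rewrite -te le_max lexx orbT.
exists (fun a t b i => `[< A a (e t b i) >]) => F psi.
(* A stage closed under [K] contains the codes of all arguments below it and the values of [psi] on
   all finite conditions below it. *)
pose K b := (fun x => e x.1.1 x.1.2 x.2) @`
    (([set: T] `*` [set c | c <= b]) `*` [set i | upto b i]) `|`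
  psi @` [set p | forall i, i \in p -> upto b i.1].
have cK b : countable (K b).
  apply: countableU; apply: countable_image.
    apply: countableX; last exact: countable_upto.
    by apply: countableX => //; apply: countable_le.
  rewrite (_ : [set p | _] = [set p | forall i, i \in p ->
    ([set i | upto b i] `*` [set: bool]) i]); last first.
    by apply/seteqP; split=> p pb i ip; have := pb i ip; [split|case].
  apply: countable_seq; apply: countableX; [exact: countable_upto|exact: countableP].
pose S := [set c | exists t b i, c = e t b i /\ F t b i].
have [a [/= Sa [bota acl]]] := diaA S _ (club_closure W1 botP cK).
exists a; split=> // [p pa|t b i ba ia].
  have [|b [_ ba pb]] := @below_exists bot a (map fst p) bota.
    by move=> i /mapP[q qp ->]; apply: pa.
  by apply: (acl b) => //; right; exists p => // i ip; apply/pb/map_f.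
have ea : e t b i < a.
  apply: (acl (top b i)).
    by case: (i) ia => //= c ca; rewrite gt_max ba.
  left; exists (t, b, i) => //; split; first split => //=.
    by case: (i) => //= c; rewrite le_max lexx.
  by case: (i) => //= c; rewrite le_max lexx orbT.
rewrite -Sa; apply/asboolP/idP => [[[t' [b' [i' [/eI[-> -> ->]]]]]]//|Fi].
by split=> //; exists t, b, i.
Qed.

End Guess.

(** Cut the natural numbers into consecutive finite blocks such that each [i] has a member of [E i]
    inside every late block, and let [t] be the parity of the block. *)
Lemma alternating_selection (J : Type) (D : set J) (E : J -> set (set nat)) :
  countable D ->
  (forall i n, D i -> exists e m, E i e /\ forall k, e k -> (n <= k < m)%N) ->
  exists t : nat -> bool, forall i n b, D i ->
    exists e, E i e /\ forall k, e k -> (n <= k)%N /\ t k = b.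
Proof.
move=> /countable_injP[h hI] DE.
have step m N : exists m', (m < m')%N /\ forall i, D i -> (h i < N)%N ->
    exists e, E i e /\ forall k, e k -> (m <= k < m')%N.
  elim: N => [|N [m' [mm' IH]]]; first by exists m.+1.
  have [[i [Di hi]]|nD] := pselect (exists i, D i /\ h i = N).
    have [e [m'' [Ee em'']]] := DE i m Di.
    exists (maxn m' m''); split=> [|i' Di']; first by rewrite leq_max mm'.
    rewrite ltnS leq_eqVlt => /orP[/eqP hi'|/(IH _ Di')[e' [Ee' em']]].
      have <- : i = i' by apply: hI; [apply: mem_set..|rewrite hi].
      exists e; split=> // k /em''/andP[-> km]; by rewrite leq_max km orbT.
    by exists e'; split=> // k /em'/andP[-> km]; rewrite leq_max km.
  exists m'; split=> // i Di; rewrite ltnS leq_eqVlt => /orP[/eqP hi|]; last exact: IH.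
  by exfalso; apply: nD; exists i.
(* With the bound on codes equal to the start [m] of the block, [i] is served in every block that
   starts beyond [h i]. *)
have [s sP] := choice (fun m => step m m).
pose u r := iter r s 0%N.
have uS r : (u r < u r.+1)%N by have [] := sP (u r).
have ule r r' : (r <= r')%N -> (u r <= u r')%N.
  elim: r' => [|r' IH]; first by rewrite leqn0 => /eqP->.
  rewrite leq_eqVlt => /orP[/eqP->//|/IH h']; exact: leq_trans h' (ltnW (uS _)).
have ur r : (r <= u r)%N by elim: r => // r IH; apply: leq_trans (uS r).
have uniq_block r r' k : (u r <= k < u r.+1)%N -> (u r' <= k < u r'.+1)%N -> r = r'.
  move=> /andP[a1 a2] /andP[b1 b2]; apply/eqP; rewrite eqn_leq; apply/andP; split;
    rewrite leqNgt; apply/negP => /ule.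
    by move=> h'; have := leq_trans (leq_trans b2 h') a1; rewrite ltnn.
  by move=> h'; have := leq_trans (leq_trans a2 h') b1; rewrite ltnn.
exists (fun k => `[< exists r, odd r /\ (u r <= k < u r.+1)%N >]) => i n b Di.
(* Doubling leaves the parity of [r] to [b]; the maximum makes the block start at or after [n] and
   beyond [h i]. *)
pose r := ((maxn n (h i).+1).*2 + b)%N.
have rn : (maxn n (h i).+1 <= r)%N by rewrite /r -addnn -addnA leq_addr.
have oddr : odd r = b by rewrite oddD odd_double; case: (b).
have hr : (h i < u r)%N.
  by apply: leq_trans (ur r); apply: leq_trans rn; rewrite leq_max leqnn orbT.
have [_ /(_ i Di hr)[e [Ee er]]] := sP (u r).
exists e; split=> // k /er kr; split.
  have /andP[h' _] := kr; apply: leq_trans h'; apply: leq_trans (ur r).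
  by apply: leq_trans rn; rewrite leq_max leqnn.
apply/asboolP/idP => [[r' [o' kr']]|bT]; first by rewrite -oddr (uniq_block _ _ _ kr kr').
by exists r; rewrite oddr.
Qed.

(** * The tower of splittings *)

Section Tower.
Context (d : Order.disp_t) (W : orderType d) (W1 : is_omega1 W).
Context (bot : W) (botP : forall b, bot <= b).
Local Notation coord := (coord W).
Local Notation point := (coord -> bool).
Context (G : W -> option (bool * nat) -> W -> point).
Context (j : W -> nat -> coord).
Hypothesis j_below : forall a n, below a (j a n).
Hypothesis j_surj : forall a i, below a i -> exists n, j a n = i.

Definition agree (a : W) (y z : point) := forall i, below a i -> y i = z i.

Lemma agree_sym a y z : agree a y z -> agree a z y.
Proof. by move=> h i /h. Qed.

Lemma agree_trans a y z t : agree a y z -> agree a z t -> agree a y t.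
Proof. by move=> yz zt i ia; rewrite yz// zt. Qed.

Lemma agree_le a b y z : a <= b -> agree b y z -> agree a y z.
Proof. by move=> ab yz i ia; apply/yz/(below_lt ab). Qed.

(* In the guess [G g], the tag [None] holds the point to be split (stored at the
   index [bot]), [Some (false, n)] the family [u] and [Some (true, n)] the family [v]. *)
Definition split_point (g : W) : point := G g None bot.

Definition level (g : W) (y : point) (k : nat) : Prop :=
  y (j g k) <> split_point g (j g k) /\
  forall l, (l < k)%N -> y (j g l) = split_point g (j g l).

Lemma level_exists g y : ~ agree g y (split_point g) -> exists k, level g y k.
Proof.
move=> nag.
have ex : exists k, y (j g k) != split_point g (j g k).
  apply: contrapT => nk; apply: nag => i /j_surj[n <-].
  by apply: contrapT => /eqP ne; apply: nk; exists n.
exists (ex_minn ex); case: ex_minnP => k /eqP yk kmin; split=> // l lk.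
by apply/eqP; apply: contraTT lk => /kmin; rewrite -leqNgt.
Qed.

Lemma level_eq g y z k : (forall l, (l <= k)%N -> y (j g l) = z (j g l)) ->
  level g z k -> level g y k.
Proof. by move=> yz [zk zl]; split=> [|l lk]; rewrite yz// ?zl// ltnW. Qed.

Lemma level_agree g y z k : agree g y z -> level g y k -> level g z k.
Proof. by move=> yz [yk yl]; split=> [|l lk]; rewrite -yz// yl. Qed.

Lemma level_inj g y k l : level g y k -> level g y l -> k = l.
Proof. by move=> [yk ylk] [yl yll]; case: (ltngtP k l) => // [/yll|/ylk]. Qed.

(** A point over the split point has no level, so both values of its coordinate [inr g] are allowed:
    this is the splitting. *)
Definition cond (L : W -> nat -> bool) (g : W) (y : point) :=
  forall k, level g y k -> y (inr g) = L g k.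

Definition cond_below L (g : W) (y : point) := forall b, b < g -> cond L b y.

Definition limit_space L : set point := [set y | forall g, cond L g y].

(* [D] and [x] matter only through their restrictions to the coordinates below
   [a]; what accumulates at [x], in the space of stage [g], are the fibres over
   these restrictions of the points of [D]. *)
Definition star L (g a : W) (D : set point) (x : point) :=
  forall s : seq coord, (forall i, i \in s -> below g i) ->
  exists e, [/\ D e, ~ agree a e x &
    forall y, cond_below L g y -> agree a y e -> {in s, y =1 x}].

(* [starS L g] is [star] at the successor of [g]. *)
Definition starS L (g a : W) (D : set point) (x : point) :=
  forall s : seq coord, (forall i, i \in s -> upto g i) ->
  exists e, [/\ D e, ~ agree a e x &
    forall y, cond_below L g y -> cond L g y -> agree a y e -> {in s, y =1 x}].

(* [None] promises the whole cube on the coordinates [nat] (it keeps the space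
   perfect), [Some (a, None)] the family [u] guessed at stage [a], and
   [Some (a, Some c)] the part of [v] over the half [c] of [u]. *)
Definition family : Type := option (W * option bool).

Definition base (f : family) : W := if f is Some (a, _) then a else bot.

Definition member (L : W -> nat -> bool) (f : family) : set point :=
  match f with
  | None => setT
  | Some (a, None) => [set e | exists n b, b < a /\ e = G a (Some (false, n)) b]
  | Some (a, Some c) => [set e | exists n b, [/\ b < a,
      e = G a (Some (true, n)) b &
      exists k, level a (G a (Some (false, n)) b) k /\ L a k = c]]
  end.

(** The inequality is strict for a part of [v] because that part is defined from [L a]; thus the
    requirement on [L g] refers only to earlier values. *)
Definition active (f : family) (g : W) : Prop :=
  match f with
  | None => True
  | Some (a, None) => a <= g
  | Some (a, Some _) => a < g
  end.

Lemma base_active f g : active f g -> base f <= g.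
Proof. by case: f => [[a [c|]]|] //= /ltW. Qed.

(** This makes a promised family that accumulates at the split point accumulate at both halves. The
    value [b] is required on whole fibres, so that [star] is inherited by the next stage. *)
Definition good L (g : W) (t : nat -> bool) :=
  forall f, active f g -> star L g (base f) (member L f) (split_point g) ->
  forall n b, exists e, [/\ member L f e, ~ agree (base f) e (split_point g) &
    forall y, cond_below L g y -> agree (base f) y e ->
    forall k, level g y k -> (n <= k)%N /\ t k = b].

Lemma cond_belowE L L' g : (forall b, b < g -> L b = L' b) ->
  cond_below L g = cond_below L' g.
Proof.
move=> LL'; apply/funext => y; apply/propext.
by split=> h b bg k /(h b bg); rewrite LL'.
Qed.

Lemma good_local L L' g t : (forall b, b < g -> L b = L' b) ->
  good L g t -> good L' g t.
Proof.
move=> LL' gd f fg; have mE : member L f = member L' f.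
  by case: f fg => [[a [c|]]|] //= ag; rewrite LL'.
have := gd f fg; rewrite /star mE (cond_belowE LL'); exact.
Qed.

(** Only countably many families are active at [g]. The selection lemma is applied to the sets of
    levels that occur in the fibre over one member of a family. *)
Lemma good_exists L g : exists t, good L g t.
Proof.
pose D := [set f | active f g /\ star L g (base f) (member L f) (split_point g)].
pose E f := [set e : set nat | exists y0, [/\ member L f y0,
  ~ agree (base f) y0 (split_point g) &
  e = [set k | exists y, [/\ cond_below L g y, agree (base f) y y0 & level g y k]]]].
have cD : countable D.
  apply: (@sub_countable _ _ _ ([set None] `|`
      Some @` ([set a | a <= g] `*` [set: option bool]))).
    apply: subset_card_le => f [fg _].
    move: (base_active fg); case: f {fg} => [[a c] ag|]; [right|by left].
    by exists (a, c).
  apply: countableU; first exact: countable1.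
  apply: countable_image; apply: countableX; last exact: countableP.
  exact: countable_le.
have [|t tP] := alternating_selection (E := E) cD.
  move=> f n [fg st].
  have [|e [me ne ey]] := st (map (j g) (iota 0 n)).
    by move=> i /mapP[k _ ->].
  (* Agreement on the first [n] places gives levels at least [n]. The upper bound comes from one
     place below [base f] where [e] leaves the split point, since the whole fibre over [e] does so
     there. *)
  have [i [ia ei]] : exists i, below (base f) i /\ e i <> split_point g i.
    apply: contrapT => nh; apply: ne => i ia; apply: contrapT => ni.
    by apply: nh; exists i.
  have [l jl] := j_surj (below_lt (base_active fg) ia).
  exists [set k | exists y, [/\ cond_below L g y, agree (base f) y e & level g y k]].
  exists l.+1; split; first by exists e.
  move=> k [y [cy ye [yk yl]]]; apply/andP; split.
    rewrite leqNgt; apply/negP => kn; apply: yk; apply: (ey y) => //.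
    by apply: map_f; rewrite mem_iota.
  rewrite ltnS leqNgt; apply/negP => /yl; rewrite jl ye//.
exists t => f fg st n b; have [_ [[e [me ne ->]] et]] := tP f n b (conj fg st).
exists e; split=> // y cy ye k yk; apply: et; by exists y.
Qed.

Lemma tower_exists : exists L, forall g, good L g (L g).
Proof.
apply: (@omega1_rec_choice _ _ W1 _ (fun=> true) (fun g L t => good L g t)).
- by move=> g L L' t; apply: good_local.
- by move=> g L _; apply: good_exists.
Qed.

(** * Points and accumulation in the limit space *)

Section LimitSpace.
Context (L : W -> nat -> bool) (Lgood : forall g, good L g (L g)).
Local Notation X := (limit_space L).

Lemma limit_space_below g y : X y -> cond_below L g y.
Proof. by move=> Xy b _; apply: Xy. Qed.

(** The coordinates [inr g] are filled in recursively: a level determines the value, and over the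
    split point any value will do. *)
Lemma limit_space_extend (c : nat -> bool) : exists y, X y /\ forall n, y (inl n) = c n.
Proof.
pose glue (f : W -> bool) : point := fun i => match i with inl n => c n | inr b => f b end.
have [f g h t fg ft k|g f _|f fP] := @omega1_rec_choice _ _ W1 _ true
    (fun g f t => forall k, level g (glue f) k -> t = L g k).
- move=> lk; apply: ft; apply: level_agree lk => -[//|b] /= /fg; by [].
- have [[k lk]|nk] := pselect (exists k, level g (glue f) k).
    by exists (L g k) => l /(level_inj lk) <-.
  by exists true => k lk; exfalso; apply: nk; exists k.
- by exists (glue f); split=> // g k /fP.
Qed.

(** Through this, a large level at [g] implies agreement with the split point on a given finite
    set. *)
Lemma j_cover g (s : seq coord) : (forall i, i \in s -> below g i) ->
  exists n, forall i, i \in s -> exists2 l, (l < n)%N & j g l = i.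
Proof.
elim: s => [|i s IH] sg; first by exists 0%N.
have [i' i's|n nP] := IH; first by apply: sg; rewrite inE i's orbT.
have [l jl] := j_surj (sg i (mem_head _ _)).
exists (maxn n l.+1) => i'; rewrite inE => /orP[/eqP->|/nP[l' l'n <-]].
  by exists l; rewrite ?leq_max ?leqnn ?orbT.
by exists l'; rewrite ?leq_max ?l'n.
Qed.

(** If [x] is off the split fibre, nearby points share its level and hence its value at [inr g].
    Otherwise [x] agrees with the split point below [g], and [good] is applied with the value
    [x (inr g)]. *)
Lemma star_step f g x : active f g -> X x ->
  star L g (base f) (member L f) x -> starS L g (base f) (member L f) x.
Proof.
move=> fg Xx st s sg.
pose s0 := [seq i <- s | below g i].
have s0g i : i \in s0 -> below g i by rewrite mem_filter => /andP[].
have sE i : i \in s -> i \in s0 \/ i = inr g.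
  move=> si; rewrite mem_filter si andbT; have := sg i si.
  case: i {si} => [n _|b /=]; first by left.
  by rewrite le_eqVlt => /orP[/eqP->|->]; [right|left].
have [xg|nxg] := pselect (agree g x (split_point g)); last first.
  have [k xk] := level_exists nxg.
  have [|e [me ne ey]] := st (s0 ++ map (j g) (iota 0 k.+1)).
    by move=> i; rewrite mem_cat => /orP[/s0g//|/mapP[l _ ->]].
  exists e; split=> // y cy cgy ye i /sE[si|->].
    by apply: (ey y) => //; rewrite mem_cat si.
  have yk : level g y k.
    apply: level_eq xk => l lk; apply: (ey y) => //.
    by rewrite mem_cat map_f ?orbT// mem_iota.
  by rewrite (cgy _ yk) (Xx _ _ xk).
have nag y : ~ agree (base f) y x -> ~ agree (base f) y (split_point g).
  move=> ny yg; apply: ny; apply: agree_trans yg _.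
  by apply: agree_sym; apply: agree_le xg; apply: base_active.
have [|n nP] := @j_cover g s0; first by [].
have [|e [me ne ey]] := Lgood fg _ n (x (inr g)).
  move=> s' s'g; have [e [me ne ey]] := st s' s'g.
  by exists e; split=> [//||y cy ye i is']; [exact: nag|rewrite (ey y)// xg// s'g].
exists e; split=> // [ex|y cy cgy ye i /sE[si|->]].
- by apply: ne; apply: agree_trans ex (agree_le (base_active fg) xg).
- have [k yk] : exists k, level g y k.
    apply: level_exists => yg; apply: ne.
    exact: agree_trans (agree_sym ye) (agree_le (base_active fg) yg).
  have [nk _] := ey y cy ye k yk; have [l ln jl] := nP i si.
  by rewrite -jl yk.2 ?xg// (leq_trans ln).
- have [k yk] : exists k, level g y k.
    apply: level_exists => yg; apply: ne.
    exact: agree_trans (agree_sym ye) (agree_le (base_active fg) yg).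
  by have [_ Lk] := ey y cy ye k yk; rewrite (cgy _ yk).
Qed.

(** The induction starts from the successor of [base f] because a part of [v] is not yet active at
    its own stage. *)
Lemma star_all f x : X x -> (forall g, base f < g -> active f g) ->
  starS L (base f) (base f) (member L f) x ->
  forall g, base f < g -> star L g (base f) (member L f) x.
Proof.
move=> Xx fact st0; elim/(omega1_ind W1) => g IH ag s sg.
have [b [ab bg sb]] := below_exists ag sg.
have st : starS L b (base f) (member L f) x.
  move: ab; rewrite le_eqVlt => /orP[/eqP<-//|ab].
  by apply: star_step => //; [apply: fact|apply: IH].
have [e [me ne ey]] := st s sb.
exists e; split=> // y cy; apply: ey; last exact: cy b bg.
by move=> c cb; apply: cy; apply: lt_trans bg.
Qed.

Lemma exists_below (s : seq coord) (a : W) :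
  exists c, a < c /\ forall i, i \in s -> below c i.
Proof.
elim: s => [|i s [g [ag sg]]]; first by have [g ag] := omega1_gt W1 a; exists g.
pose m := if i is inr b then Order.max g b else g.
have gm : g <= m by rewrite /m; case: (i) => // b; rewrite le_max lexx.
have [c mc] := omega1_gt W1 m; exists c; split.
  exact: lt_trans ag (le_lt_trans gm mc).
move=> i'; rewrite inE => /orP[/eqP->|/sg]; last first.
  by apply: below_lt; apply: ltW; apply: le_lt_trans mc.
by move: mc; rewrite /m; case: (i) => //= b; rewrite gt_max => /andP[].
Qed.

Lemma fibres_converge f x : X x -> (forall g, base f < g -> active f g) ->
  starS L (base f) (base f) (member L f) x ->
  forall s : seq coord, exists e, [/\ member L f e, ~ agree (base f) e x &
    forall y, X y -> agree (base f) y e -> {in s, y =1 x}].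
Proof.
move=> Xx fact st0 s.
have [g [ag sg]] := exists_below s (base f).
have [e [me ne ey]] := star_all Xx fact st0 ag sg.
by exists e; split=> // y Xy; apply: ey; apply: limit_space_below.
Qed.

Lemma limit_space_perfect x (s : seq coord) : X x ->
  exists y, [/\ X y, y <> x & {in s, y =1 x}].
Proof.
move=> Xx.
have st0 : starS L bot bot setT x.
  apply: (@star_step None) => // s' s'b.
  (* Flipping a coordinate [inl n] beyond all those in [s'] leaves [x] unchanged on [s']. *)
  pose n := (\max_(i <- s') (if i is inl n then n else 0)).+1%N.
  have ns : inl n \notin s'.
    apply/negP => ns; have := @leq_bigmax_seq _ s' xpredT
      (fun i : coord => if i is inl n then n else 0%N) _ ns isT.
    by rewrite /= -/n ltnn.
  exists (fun i => if i == inl n then ~~ x i else x i); split=> //.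
    by move=> /(_ (inl n) isT); rewrite eqxx; case: (x _).
  move=> y _ yx i is'; rewrite yx ?s'b//.
  by case: eqP is' ns => // -> ->.
have [e [_ ne ey]] := @fibres_converge None x Xx (fun _ _ => I) st0 s.
have [y [Xy yc]] := limit_space_extend (fun n => e (inl n)).
have ye : agree bot y e.
  by move=> -[n _|b /= ]; [exact: yc|rewrite ltNge botP].
exists y; split=> //; last exact: ey.
by move=> yx; apply: ne; rewrite -yx; apply: agree_sym.
Qed.

(** * Consequences of the guesses *)

Hypothesis G_guess : forall (F : option (bool * nat) -> W -> point)
  (psi : seq (coord * bool) -> W), exists a, [/\ bot < a,
    forall p, (forall i, i \in p -> below a i.1) -> psi p < a &
    forall t b i, b < a -> below a i -> G a t b i = F t b i].

Lemma point_neq (y z : point) : y <> z -> exists i, y i <> z i.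
Proof.
move=> yz; apply: contrapT => nh; apply: yz; apply/funext => i.
by apply: contrapT => ni; apply: nh; exists i.
Qed.

Lemma separating_stage (u : nat -> point) (x : point) : (forall n, u n <> x) ->
  exists c, forall n a, c < a -> ~ agree a (u n) x.
Proof.
move=> ux; have /choice[i iP] n := point_neq (ux n).
have /choice[g gP] n := exists_below [:: i n] bot.
have [c cP] := countable_bounded W1 (countable_image g (countableP [set: nat])).
exists c => n a ca ag; apply: (iP n); apply: ag.
apply: (@below_lt _ _ (g n)); last by apply: (gP n).2; rewrite mem_head.
by apply: ltW; apply: lt_trans ca; apply: cP; exists n.
Qed.

(** Closure of the guessing stage [a] under [psi] makes the terms before [a] accumulate at the
    restriction of [y a]. The promise carries this to all later stages, which puts [y a] in the
    closure of the earlier terms. *)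
Lemma limit_space_no_left_separated (y : W -> point) : (forall a, X (y a)) ->
  ~ forall a, exists s : seq coord, forall b, b < a -> ~ {in s, y b =1 y a}.
Proof.
move=> Xy sep.
pose inbox (p : seq (coord * bool)) (z : point) := forall q, q \in p -> z q.1 = q.2.
have /choice[psi psiP] : forall p, exists c, (forall b, inbox p (y b) -> b < c) \/
    exists b1 b2 i, [/\ b1 < c, b2 < c, below c i & [/\ inbox p (y b1),
      inbox p (y b2) & y b1 i <> y b2 i]].
  move=> p; have [[b1 [b2 [p1 p2 b12]]]|nb] :=
      pselect (exists b1 b2, [/\ inbox p (y b1), inbox p (y b2) & y b1 <> y b2]).
    have [i ib] := point_neq b12.
    have [c [bc cP]] := exists_below [:: i; inr b1] b2.
    exists c; right; exists b1, b2, i; split=> //.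
      by apply: (cP (inr b1)); rewrite !inE eqxx orbT.
    by apply: cP; rewrite mem_head.
  have [[b pb]|nb'] := pselect (exists b, inbox p (y b)); last first.
    by exists bot; left=> b pb; exfalso; apply: nb'; exists b.
  have [c bc] := omega1_gt W1 b; exists c; left=> b' pb'.
  have [eb|//] := eqVneq b b'; first by rewrite -eb.
  move=> /eqP nbb'; exfalso; apply: nb; exists b, b'; split=> // eyb.
  case: (ltgtP b b') nbb' => // [bb'|b'b] _.
    by have [s sP] := sep b'; apply: (sP b bb') => i _; rewrite eyb.
  by have [s sP] := sep b; apply: (sP b' b'b) => i _; rewrite eyb.
have [a [bota apsi Ga]] := G_guess (fun t b i => y b i) psi.
pose f : family := Some (a, None).
have GE n b : b < a -> agree a (G a (Some (false, n)) b) (y b).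
  by move=> ba i ia; apply: Ga.
have st0 : star L a a (member L f) (y a).
  move=> s sa; pose p := [seq (i, y a i) | i <- s].
  have pa : psi p < a by apply: apsi => q /mapP[i si ->]; apply: sa.
  have pin b : inbox p (y b) -> {in s, y b =1 y a}.
    by move=> pb i si; apply: (pb (i, y a i)); apply: map_f.
  have key b i : b < a -> below a i -> inbox p (y b) -> y b i <> y a i ->
      exists e, [/\ member L f e, ~ agree a e (y a) &
        forall z, cond_below L a z -> agree a z e -> {in s, z =1 y a}].
    move=> ba ia pb nb; exists (G a (Some (false, 0%N)) b); split.
    - by exists 0%N, b.
    - by move=> ag; apply: nb; rewrite -(GE 0%N)// ag.
    - by move=> z _ ze i' si'; rewrite ze ?sa// GE ?sa// (pin b pb).
  (* The box [p] contains [y a], so the first case would give [a < psi p < a]. In the second, one of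
     two differing terms also differs from [y a], at a coordinate below [a]. *)
  case: (psiP p) => [h|[b1 [b2 [i [b1a b2a ia [p1 p2 n12]]]]]].
    have : a < psi p by apply: h => q /mapP[i si ->].
    by move=> /lt_trans/(_ pa); rewrite ltxx.
  have [e1|n1] := eqVneq (y b1 i) (y a i); last first.
    by apply: (key b1 i) => //; [exact: lt_trans pa|
      exact: below_lt (ltW pa) ia|exact/eqP].
  apply: (key b2 i) => //; [exact: lt_trans pa| exact: below_lt (ltW pa) ia|].
  by rewrite -e1 => e2; apply: n12.
have [s sP] := sep a.
have [|e [[n [b [ba eE]]] _ ey]] :=
    @fibres_converge f (y a) (Xy a) (fun g ag => ltW ag) _ s.
  exact: (@star_step f a (y a) (lexx a)).
apply: (sP b ba); apply: ey => //; rewrite eE.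
exact/agree_sym/GE.
Qed.

Lemma limit_space_no_convergent (u : nat -> point) (x : point) :
  (forall n, X (u n)) -> X x ->
  (forall i, exists N, forall n, (N <= n)%N -> u n i = x i) ->
  exists N, forall n, (N <= n)%N -> u n = x.
Proof.
move=> Xu Xx cvg; apply: contrapT => nev.
have often N : exists n, (N <= n)%N /\ u n <> x.
  apply: contrapT => nN; apply: nev; exists N => n Nn.
  by apply: contrapT => ne; apply: nN; exists n.
have cvgs (s : seq coord) : exists N, forall n, (N <= n)%N -> {in s, u n =1 x}.
  elim: s => [|i s [N NP]]; first by exists 0%N.
  have [N' N'P] := cvg i; exists (maxn N N') => n.
  rewrite geq_max => /andP[Nn N'n] i'; rewrite inE => /orP[/eqP->|]; first exact: N'P.
  exact: NP.
(* Terms equal to [x] are replaced by other terms, so that one separating stage serves the whole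
   sequence. *)
have /choice[w wP] : forall n, exists m, u m <> x /\ (u n <> x -> m = n).
  move=> n; have [e|ne] := pselect (u n = x); last by exists n.
  by have [m [_ ne]] := often 0%N; exists m.
have [c cP] := separating_stage (fun n => (wP n).1).
have {cP} cP n a : c < a -> u n <> x -> ~ agree a (u n) x.
  by move=> ca ne; have := cP n a ca; rewrite (wP n).2.
have [a [bota apsi Ga]] := G_guess (fun t b i =>
  if t is Some (_, n) then u n i else x i) (fun=> c).
have ca : c < a by apply: (apsi [::]).
pose f : family := Some (a, None).
have GE n b : b < a -> agree a (G a (Some (false, n)) b) (u n).
  by move=> ba i ia; rewrite Ga.
have GxE : agree a (split_point a) x by move=> i ia; rewrite /split_point Ga.
have [N NP] := cvg (inr a).
(* Once [m] exceeds the levels of the first [N] terms, a term of level at least [m] has index at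
   least [N] and so agrees with [x] at [inr a]. *)
have [m mP] : exists m, forall n k, (n < N)%N -> level a (u n) k -> (k < m)%N.
  elim: (N) => [|N' [m mP]]; first by exists 0%N.
  have [[k lk]|nk] := pselect (exists k, level a (u N') k).
    exists (maxn m k.+1) => n l; rewrite ltnS leq_eqVlt leq_max => /orP[/eqP->|nN'].
      by move=> /(level_inj lk) ->; rewrite leqnn orbT.
    by move=> /(mP _ _ nN') ->.
  exists m => n l; rewrite ltnS leq_eqVlt => /orP[/eqP->|nN'] ll; last exact: mP ll.
  by exfalso; apply: nk; exists l.
have [|e [[n [b [ba eE]]] ne ey]] := Lgood (f := f) (lexx a) _ m (~~ x (inr a)).
  move=> s sa; have [N' N'P] := cvgs s; have [n [N'n un]] := often N'.
  exists (G a (Some (false, n)) bot); split.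
  - by exists n, bot.
  - move=> ag; apply: (cP n a ca un).
    exact: agree_trans (agree_sym (GE n bot bota)) (agree_trans ag GxE).
  - by move=> z _ ze i si; rewrite ze ?sa// GE ?sa// GxE ?sa// N'P.
have une : agree a (u n) e by rewrite eE; apply/agree_sym/GE.
have [k lk] : exists k, level a (u n) k.
  by apply: level_exists => ag; apply: ne; apply: agree_trans ag; apply: agree_sym.
have [mk Lk] := ey (u n) (limit_space_below (Xu n)) une k lk.
have := Xu n a k lk; rewrite Lk; case: (leqP N n) => [/NP->|nN _].
  by case: (x _).
by have := mP n k nN lk; rewrite ltnNge mk.
Qed.

(** In the application [z] and [v n] are the images of [x] and [u n] under a homeomorphism; the last
    two conditions on [s] and [q] are its continuity at [x] and that of its inverse at [z], in terms
    of basic boxes. *)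
Lemma limit_space_no_displacement (x z : point) (u v : nat -> point) :
  X x -> X z -> (forall n, X (u n)) -> (forall n, X (v n)) ->
  (forall n, u n <> x) -> (forall n, v n <> z) -> x <> z ->
  (forall s : seq coord, exists n, {in s, u n =1 x}) ->
  (forall s : seq coord, exists q : seq coord,
    forall n, {in q, u n =1 x} -> {in s, v n =1 z}) ->
  ~ (forall q : seq coord, exists s : seq coord,
    forall n, {in s, v n =1 z} -> {in q, u n =1 x}).
Proof.
move=> Xx Xz Xu Xv ux vz xz acc /choice[phi phiP] bwd.
have [c1 c1P] := separating_stage ux.
have [c2 c2P] := separating_stage vz.
have [c3 c3P] := separating_stage (fun _ : nat => xz).
(* Closure under [psi] puts [a] beyond the separating stages and keeps [phi] of finitely many
   coordinates below [a] below [a]. *)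
have /choice[psi psiP] : forall p : seq (coord * bool), exists c, [/\ c1 < c, c2 < c, c3 < c &
    forall i, i \in phi (map fst p) -> below c i].
  move=> p.
  have [c [c1c cP]] := exists_below (phi (map fst p) ++ [:: inr c2; inr c3]) c1.
  exists c; split=> //.
  - by apply: (cP (inr c2)); rewrite mem_cat !inE eqxx orbT.
  - by apply: (cP (inr c3)); rewrite mem_cat !inE eqxx !orbT.
  - by move=> i ip; apply: cP; rewrite mem_cat ip.
have [a [bota apsi Ga]] := G_guess (fun t b i => match t with
  None => x i | Some (false, n) => u n i | Some (true, n) => v n i end) psi.
have [/lt_trans c1a /lt_trans c2a /lt_trans c3a _] := psiP [::].
have {}c1a : c1 < a by apply: c1a; apply: apsi.
have {}c2a : c2 < a by apply: c2a; apply: apsi.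
have {}c3a : c3 < a by apply: c3a; apply: apsi.
have uE n b : b < a -> agree a (G a (Some (false, n)) b) (u n).
  by move=> ba i ia; rewrite Ga.
have vE n b : b < a -> agree a (G a (Some (true, n)) b) (v n).
  by move=> ba i ia; rewrite Ga.
have GxE : agree a (split_point a) x by move=> i ia; rewrite /split_point Ga.
pose f b : family := Some (a, b).
have unag n : ~ agree a (u n) (split_point a).
  by move=> ag; apply: (c1P n a c1a); apply: agree_trans ag GxE.
have stu : star L a a (member L (f None)) (split_point a).
  move=> s sa; have [n nP] := acc s.
  exists (G a (Some (false, n)) bot); split; first by exists n, bot.
  - move=> ag; apply: (@unag n); apply: agree_trans ag.
    exact/agree_sym/uE.
  - by move=> y _ ye i si; rewrite ye ?sa// uE ?sa// GxE ?sa// nP.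
have [k lk] : exists k, level a z k.
  apply: level_exists => ag; apply: (c3P 0%N a c3a).
  exact: agree_sym (agree_trans ag GxE).
(* By [good], some [u n] of value [b] at [inr a] is close enough to [x] for [v n] to be close to
   [z]. The first [k + 1] places are added to [s] to give points over [v n] the level of [z], hence
   its value at [inr a]. *)
have stv b : starS L a a (member L (f (Some b))) z.
  move=> s sa.
  pose s' := [seq i <- s | below a i] ++ map (j a) (iota 0 k.+1).
  have s'a i : i \in s' -> below a i.
    by rewrite mem_cat mem_filter => /orP[/andP[]//|/mapP[l _ ->]].
  pose p := [seq (i, true) | i <- s'].
  have pa : psi p < a by apply: apsi => q /mapP[i /s'a ? ->].
  have [_ _ _ phia] := psiP p.
  have ps' : map fst p = s' by rewrite -map_comp map_id.
  have [m mP] : exists m, forall i, i \in phi s' -> exists2 l, (l < m)%N & j a l = i.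
    apply: j_cover => i; rewrite -ps' => /phia; exact/below_lt/ltW.
  have [e [[n [c [ca eE]]] ne ey]] := Lgood (f := f None) (lexx a) stu m b.
  have une : agree a (u n) e by rewrite eE; apply/agree_sym/uE.
  have [l ll] := level_exists (@unag n).
  have [ml Ll] := ey (u n) (limit_space_below (Xu n)) une l ll.
  have vs' : {in s', v n =1 z}.
    apply: phiP => i /mP[l' l'm <-].
    by rewrite ll.2 ?GxE// (leq_trans l'm).
  exists (G a (Some (true, n)) c); split.
  - exists n, c; split=> //; exists l; split=> //.
    exact: level_agree (agree_sym (uE n c ca)) ll.
  - by move=> ag; apply: (c2P n a c2a); apply: agree_trans ag; apply/agree_sym/vE.
  - move=> y cy cay ye; have ys' : {in s', y =1 z}.
      by move=> i is'; rewrite ye ?s'a// vE ?s'a// vs'.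
    have yk : level a y k.
      apply: level_eq lk => l' l'k; apply: ys'.
      by rewrite mem_cat map_f ?orbT// mem_iota.
    move=> i si; have := sa i si; case: i si => [i|i] si.
      by move=> _; apply: ys'; rewrite mem_cat mem_filter si.
    rewrite /= le_eqVlt => /orP[/eqP->|ia]; first by rewrite (cay k yk) (Xz a k lk).
    by apply: ys'; rewrite mem_cat mem_filter si /= ia.
(* The promise for the wrong half yields [v n] close to [z] while [u n] differs from [x] at
   [inr a]. *)
have [s sP] := bwd [:: inr a].
have [e [[n [b [ba eE [l [ll Ll]]]]] _ ey]] := @fibres_converge (f (Some (~~ x (inr a)))) z Xz
  (fun g ag => ag) (stv _) s.
have /sP/(_ _ (mem_head _ _)) : {in s, v n =1 z}.
  by apply: ey => //; rewrite eE; apply/agree_sym/vE.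
rewrite (Xu n a l) ?Ll; first by case: (x _).
exact: level_agree (uE n b ba) ll.
Qed.

End LimitSpace.
End Tower.

(** * Subspaces of Cantor cubes *)

Lemma nbhs_set_type (T : topologicalType) (A : set T) (x : set_type A) (U : set (set_type A)) :
  nbhs x U <-> exists2 V, nbhs (val x) V & forall y : set_type A, V (val y) -> U y.
Proof.
split=> [|[V]].
- case=> _ [/= [V oV <-] Vx VU]; exists V => //.
  by apply: open_nbhs_nbhs; split.
- move=> Vx VU.
  have h : nbhs x (val @^-1` V) := @initial_continuous _ _ (@set_val _ A) x V Vx.
  by apply: filterS h => y; apply: VU.
Qed.

Lemma nbhs_cantor_cube (I : eqType) (x : {ptws I -> bool}) (U : set {ptws I -> bool}) :
  nbhs x U <-> exists s : seq I, forall y, {in s, y =1 x} -> U y.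
Proof.
split=> [Ux|[s sU]].
- pose F := filter_from [set: seq I] (fun s => [set y : {ptws I -> bool} | {in s, y =1 x}]).
  have FF : Filter F.
    apply: filter_from_filter; first by exists [::].
    move=> s t _ _; exists (s ++ t) => // y /= yst.
    by split=> i ii; apply: yst; rewrite mem_cat ii ?orbT.
  suff /(_ U Ux)[s _ sU] : F --> x by exists s.
  apply/cvg_sup => i V [_ [/= [B oB <-] Bx BV]].
  exists [:: i] => //= y yx; apply: BV => /=.
  by rewrite yx ?mem_head.
- elim: s U sU => [|i s IH] U sU.
    by apply: filterS filterT => y _; apply: sU.
  have Us := IH [set y : {ptws I -> bool} | {in s, y =1 x}] (fun=> id).
  have Ui : nbhs x [set y : {ptws I -> bool} | y i = x i].
    have /(_ [set b | b = x i]) := @proj_continuous I (fun=> bool) i x.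
    by apply; rewrite nbhs_principalE; apply/principal_filterP.
  apply: filterS (filterI Ui Us) => y [/= yi ys]; apply: sU => k.
  by rewrite inE => /orP[/eqP->|/ys].
Qed.

Lemma compact_set_type (T : topologicalType) (A : set T) :
  compact A -> compact [set: set_type A].
Proof.
move=> cA F FF _.
have [|p [Ap pF]] := cA (val @ F) (fmap_proper_filter _ FF).
  apply: (@filterS _ F _ setT) => [y _|]; [exact: (set_valP y)|exact: filterT].
exists (SigSub (mem_set Ap)); split=> // B V FB /nbhs_set_type[V' pV' V'V].
have FvB : (@set_val _ A @ F) (@set_val _ A @` B).
  by apply: (@filterS _ F _ B) FB => y By; exists y.
have [_ [[y By <-] V'y]] := pF _ _ FvB pV'.
by exists y; split=> //; apply: V'V.
Qed.

(** This replaces the topology of a subspace of a subspace by closures in [T]. *)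
Lemma separable_set_typeP (T : topologicalType) (A : set T) :
  separable (set_type A) <->
  exists B, [/\ countable B, B `<=` A & A `<=` closure B].
Proof.
split=> [[D cD dD]|[B [/countable_injP[f fI] BA AB]]].
- exists (val @` D); split; first exact: countable_image.
    by move=> _ [y _ <-]; exact: (set_valP y).
  move=> x Ax V xV; pose x' : set_type A := SigSub (mem_set Ax).
  have /nbhs_set_type : exists2 V', nbhs (val x') V' &
    forall y : set_type A, V' (val y) -> (val @^-1` V) y by exists V.
  rewrite nbhsE => -[O [oO Ox] OV].
  have [|y [Oy Dy]] := dD O _ oO; first by exists x'.
  by exists (val y); split; [exists y|apply: OV].
- exists (val @^-1` B).
    apply/countable_injP; exists (f \o val) => x y /set_mem Bx /set_mem By /= exy.
    exact/val_inj/(fI _ _ (mem_set Bx) (mem_set By) exy).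
  move=> O [x Ox] oO.
  have [V Vx VO] := (nbhs_set_type x O).1 (open_nbhs_nbhs (conj oO Ox)).
  have [y [By Vy]] := AB _ (set_valP x) V Vx.
  exists (SigSub (mem_set (BA _ By))); split=> //.
  exact: VO.
Qed.

Section SubCube.
Context (I : eqType) (X : set {ptws I -> bool}).

Lemma nbhs_subcube (x : set_type X) (U : set (set_type X)) : nbhs x U <->
  exists s : seq I, forall y : set_type X, {in s, val y =1 val x} -> U y.
Proof.
rewrite nbhs_set_type; split=> [[V /nbhs_cantor_cube[s sV] VU]|[s sU]].
  by exists s => y /sV; apply: VU.
exists [set y : {ptws I -> bool} | {in s, y =1 val x}] => //.
by apply/nbhs_cantor_cube; exists s.
Qed.

Lemma hausdorff_subcube : hausdorff_space (set_type X).
Proof.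
move=> x y xy; apply/val_inj/funext => i.
have nb (z : set_type X) : nbhs z [set t : set_type X | val t i = val z i].
  by apply/nbhs_subcube; exists [:: i] => t; apply; rewrite mem_head.
by have [t [/= <- <-]] := xy _ _ (nb x) (nb y).
Qed.

Lemma compact_subcube : closed X -> compact [set: set_type X].
Proof.
move=> cX; apply: compact_set_type; apply: subclosed_compact cX _ (subsetT X).
rewrite (_ : setT = [set y : {ptws I -> bool} | forall i, [set: bool] (y i)]).
  exact: (@tychonoff I (fun=> bool) (fun=> setT) (fun=> bool_compact)).
by apply/seteqP; split.
Qed.

End SubCube.

(** * The limit space as a topological space *)

Theorem theorem5p1 (hdiamond : diamond) :
  exists X : topologicalType,
    [/\ infinite_set [set: X]%classic, fedorchuk_space X & rigid X].
Proof.
have [d [W [W1 [A diaA]]]] := hdiamond.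
have [bot botP] := omega1_inhabited W1.
have [G Gguess] := @diamond_guess d W W1 (option (bool * nat)) bot A botP diaA.
have /choice[j jP] : forall a : W, exists u : nat -> coord W, range u = [set i | below a i].
  by move=> a; apply: countable_range; [exact: countable_below|exists (inl 0%N)].
have j_below a n : below a (j a n) by have : range (j a) (j a n) by []; rewrite jP.
have j_surj a i : below a i -> exists n, j a n = i.
  by move=> ia; have [n _ <-] : range (j a) i; [rewrite jP|exists n].
have [L Lgood] := tower_exists W1 botP G j_below j_surj.
pose X : set {ptws coord W -> bool} := limit_space bot G j L.
pose T := set_type X.
have XT (x : T) : limit_space bot G j L (val x) := set_valP x.
(* A non-separable [B] allows a recursive choice of points, each outside the closure of the earlier
   ones. *)
have hsT : hereditarily_separable T.
  move=> B; apply: contrapT => nsep.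
  have next C : countable C -> C `<=` B -> exists x, B x /\ ~ closure C x.
    move=> cC CB; apply: contrapT => nx; apply: nsep; apply/separable_set_typeP.
    exists C; split=> // x Bx; apply: contrapT => nCx; apply: nx; by exists x.
  have [t0 _] := next set0 (countable0 _) (@sub0set _ B).
  have [a f g t fg [Bt nt]|a f fP|y yP] := @omega1_rec_choice _ _ W1 _ t0
    (fun a f t => B t /\ ~ closure (f @` [set b | b < a]) t).
  - split=> //; rewrite (_ : g @` _ = f @` [set b | b < a])//.
    by apply: eq_imagel => b /fg.
  - apply: next; first exact/countable_image/countable_lt.
    by move=> _ [b ba <-]; have [] := fP b ba.
  apply: (limit_space_no_left_separated W1 botP j_below j_surj Lgood Gguess
    (y := fun a => val (y a))) => a; first exact: XT.
  have [_ /existsNP[U /not_implyP[/nbhs_subcube[s sU] nU]]] := yP a.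
  exists s => b ba ys; apply: nU; exists (y b); split; first by exists b.
  exact: sU.
have perfect (x : T) (s : seq (coord W)) : exists y : T, y <> x /\ {in s, val y =1 val x}.
  have [y [Xy yx ys]] := limit_space_perfect W1 botP j_below j_surj Lgood s (XT x).
  exists (SigSub (mem_set (Xy : X y))); split=> // /(congr1 val); exact: yx.
exists T; split.
- have /choice[c cP] : forall n, exists x : T, forall m, val x (inl m) = (m == n).
    move=> n; have [y [Xy yc]] := limit_space_extend W1 bot G j_below L (fun m => m == n).
    by exists (SigSub (mem_set (Xy : X y))).
  move=> fT; apply: infinite_nat; rewrite -(preimage_setT c).
  by apply: finite_preimage fT => m n _ _ e; apply/eqP; rewrite -(cP n) -e cP.
- split=> //.
  (* At a point of level [k], the condition at [g] involves only [inr g] and the first [k + 1]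
     places, so it passes to limits. *)
  + apply: compact_subcube => y cy g k yk.
    have [|z [Xz zy]] := cy [set z : {ptws coord W -> bool} |
        {in inr g :: map (j g) (iota 0 k.+1), z =1 y}].
      by apply/nbhs_cantor_cube; eexists => z; apply.
    rewrite -(zy (inr g) (mem_head _ _)); apply: (Xz g k).
    apply: level_eq yk => l lk; apply: zy.
    by rewrite inE map_f ?orbT// mem_iota.
  + exact: hausdorff_subcube.
  + move=> u x ux.
    have [||i|N NP] := limit_space_no_convergent W1 j_surj Lgood Gguess
        (u := fun n => val (u n)) (x := val x).
    * by move=> n; apply: XT.
    * exact: XT.
    * have /ux[N _ NP] : nbhs x [set t : T | val t i = val x i].
        by apply/nbhs_subcube; exists [:: i] => t; apply; rewrite mem_head.
      by exists N => n; apply: NP.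
    * by exists x, N => // n /NP /val_inj.
- move=> f [fc [g [gc fK _]]] x; apply: contrapT => fx.
  (* As [x] is not isolated, a countable dense subset of its complement accumulates at [x]; its
     enumeration is the sequence [u]. *)
  have /separable_set_typeP[B [cB Bx xB]] := hsT [set y | y <> x].
  have acc (s : seq (coord W)) : exists b, B b /\ {in s, val b =1 val x}.
    have [y [yx ys]] := perfect x s.
    have [|b [Bb bs]] := xB y yx [set t : T | {in s, val t =1 val y}].
      by apply/nbhs_subcube; exists s.
    by exists b; split=> // i si; rewrite bs ?ys.
  have [|u uB] := countable_range cB; first by have [b [Bb _]] := acc [::]; exists b.
  have ux n : u n <> x by apply: Bx; rewrite -uB; exists n.
  apply: (limit_space_no_displacement W1 botP j_below j_surj Lgood Gguess
    (x := val x) (z := val (f x)) (u := fun n => val (u n)) (v := fun n => val (f (u n)))) => //.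
  + by move=> n /val_inj/ux.
  + by move=> n /val_inj/(can_inj fK)/ux.
  + by move=> /val_inj/esym/fx.
  + move=> s; have [b [Bb bs]] := acc s.
    by move: Bb; rewrite -uB => -[n _ nb]; exists n; rewrite nb.
  + move=> s; have /nbhs_subcube[q qP] : nbhs x [set t | {in s, val (f t) =1 val (f x)}].
      apply: (fc x [set t : T | {in s, val t =1 val (f x)}]).
      by apply/nbhs_subcube; exists s.
    by exists q => n; apply: qP.
  + move=> q; have /nbhs_subcube[s sP] : nbhs (f x) [set t | {in q, val (g t) =1 val x}].
      apply: (gc (f x) [set t : T | {in q, val t =1 val x}]).
      by apply/nbhs_subcube; rewrite fK; exists q.
    by exists s => n /sP /=; rewrite fK.
Qed.
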